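(* For all $m\in\mathbb{N}$, $$E(X_\rho^m)\sim \Bigl(\frac{\ln(1-\rho)}{\ln\rho}\Bigr)^m\quad\text{as }\rho\uparrow 1.$$
   Context: $\mathbb{N}=\{1,2,3,\dots\}$. $f(\rho)\sim g(\rho)$ as $\rho\uparrow1$ means $\lim_{\rho\uparrow1}f(\rho)/g(\rho)=1$. Frog model (single-frog case). Fix $\rho\in(0,1)$ and let $p=\frac{1}{1+\rho}\in(\tfrac12,1)$, so that $\rho=\frac{1-p}{p}$. At each site $x\in\mathbb{Z}$ with $x\ge 0$ there is initially exactly one particle (''frog''), and there are no frogs at sites $x<0$. At time $0$ the frog at the origin is active and all others are sleeping. Active frogs perform, in discrete time, simultaneously and independently of each other, nearest-neighbour random walks on $\mathbb{Z}$, each step being $+1$ with probability $p$ and $-1$ with probability $1-p$. When an active frog visits a site containing a sleeping frog, that frog becomes active and from then on performs the same kind of random walk starting from its initial location; all random walk transitions are independent. $X_\rho$ denotes a random variable with the distribution of the negative of the minimum of the set of sites visited by active frogs (this minimum is almost surely finite, and $X_\rho\ge 0$). *)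

(* Defs.v *)
From HB Require Import structures.
From mathcomp Require Import all_boot all_order all_algebra.
From mathcomp Require Import all_classical all_reals all_analysis.

Set Implicit Arguments.
Unset Strict Implicit.
Unset Printing Implicit Defensive.

Import Order.TTheory GRing.Theory Num.Theory.
Import numFieldNormedType.Exports.

Local Open Scope classical_set_scope.
Local Open Scope ring_scope.

Definition mutually_independent (R : realType) (d d' : measure_display)
    (T : measurableType d) (T' : measurableType d') (P : probability T R)
    (I : eqType) (X : I -> {RV P >-> T'}) : Prop :=
  forall (s : seq I) (B : I -> set T'),
    uniq s -> (forall i, measurable (B i)) ->
    P (\big[setI/setT]_(i <- s) (X i @^-1` B i)) =
    (\prod_(i <- s) P (X i @^-1` B i))%E.

(** Randomness of the frog model: [xi (x, k)] tells whether the step that the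
    frog initially at [x] makes after its first [k] steps is [+1] ([true]) or
    [-1] ([false]).  The steps of a frog are counted from its activation. *)
Definition frog_steps (R : realType) (d : measure_display)
    (T : measurableType d) (P : probability T R) (rho : R)
    (xi : nat * nat -> {RV P >-> bool}) : Prop :=
  (forall i, P (xi i @^-1` [set true]) = ((1 + rho)^-1)%:E) /\
  mutually_independent xi.

Section FrogPath.
(* a realization of the steps *)
Variable b : nat * nat -> bool.

Definition frog_position (x k : nat) : int :=
  x%:Z + \sum_(j < k) (if b (x, j : nat) then 1 else -1).

(** State at time [n] of the frog initially at [x]: [None] while it sleeps,
    [Some k] if it is active and has made [k] steps. *)
Fixpoint frog_age (n x : nat) : option nat :=
  match n with
  | 0%N => if x == 0%N then Some 0%N else None
  | n'.+1 =>
    if frog_age n' x is Some k then Some k.+1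
    else if `[< exists y k, frog_age n' y = Some k /\
                            frog_position y k.+1 = x%:Z >]
    then Some 0%N else None
  end.

Definition visited_sites : set int :=
  [set z | exists n x k, frog_age n x = Some k /\ z = frog_position x k].

End FrogPath.

(** Extended-real valued, so that no value is made up on the null event that
    the visited sites are unbounded below (where it is [+oo]); elsewhere the
    infimum of this nonempty set of integers is its minimum. *)
Definition frog_X (R : realType) (b : nat * nat -> bool) : \bar R :=
  (- ereal_inf [set (z%:~R : R)%:E | z in visited_sites b])%E.

Definition frog_moment (R : realType) (d : measure_display)
    (T : measurableType d) (P : probability T R)
    (xi : nat * nat -> {RV P >-> bool}) (m : nat) : \bar R :=
  (\int[P]_w (frog_X R (fun i => xi i w) ^+ m))%E.

(* Main.v *)
Require Import Defs.
From HB Require Import structures.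
From mathcomp Require Import all_boot all_order all_algebra.
From mathcomp Require Import all_classical all_reals all_analysis.
From mathcomp Require Import measurable_realfun zify ring lra.

Set Implicit Arguments.
Unset Strict Implicit.
Unset Printing Implicit Defensive.

Import Order.TTheory GRing.Theory Num.Theory.
Import numFieldNormedType.Exports.

Local Open Scope classical_set_scope.
Local Open Scope ring_scope.

(* A frog started at [x] ever goes [j] below [x] with probability [rho ^ j], and
   almost surely every frog wakes up since the frog at the origin drifts to the
   right; hence [P (X < K)] is the product of the [1 - rho ^ j] for [j >= K],
   and [X] concentrates where [rho ^ K / (1 - rho)], the expected number of
   frogs reaching [- K], is of order 1, that is around
   [L = ln (1 - rho) / ln rho].
   Upper bound: by the union bound [P (X >= L + l) <= rho ^ l], so the excess of
   [X] over [L] has moments of order [(1 - rho) ^ - m], which is negligible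
   against [L ^ m].
   Lower bound: for [K = L (1 - y)], [P (X >= K) >= 1 - 1 / (1 + S)] with
   [S = rho ^ K / (1 - rho)]; only finitely many steps of finitely many frogs
   are needed for it.
   With [y = (- ln (1 - rho)) ^ (- 1/2)] both bounds on [E (X ^ m) / L ^ m] are
   polynomials in [y] with value 1 at [y = 0]. *)

(* The walk [b (x, k), b (x, k + 1), ...] makes a net displacement [j] in the
   direction [dir] within [n] steps. *)
Fixpoint hits (b : nat * nat -> bool) (dir : bool) (x n k j : nat) : bool :=
  if j is j'.+1 then
    if n is n'.+1 then
      hits b dir x n' k.+1 (if b (x, k) == dir then j' else j.+1)
    else false
  else true.

(** * Deterministic paths of a single walk *)

Section HittingPaths.
Variables (b : nat * nat -> bool) (x : nat).

Let step (c : bool) : int := if c then 1 else -1.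

Let sum_step_recl k n :
  \sum_(l < n.+1) step (b (x, (k + l)%N)) =
  step (b (x, k)) + \sum_(l < n) step (b (x, (k.+1 + l)%N)).
Proof.
rewrite big_ord_recl addn0; congr (_ + _).
by apply: eq_bigr => i _; rewrite /= /bump add1n addSnnS.
Qed.

Lemma hits_le dir n k j : hits b dir x n k j.+1 -> hits b dir x n k j.
Proof.
elim: n k j => [|n IHn] k [|j] //=.
by case: ifP => _ h; exact: IHn.
Qed.

Lemma hits_leq dir n k j j' : (j' <= j)%N ->
  hits b dir x n k j -> hits b dir x n k j'.
Proof.
move=> /subnK <-; elim: (j - j')%N => [//|i IHi]; rewrite addSn => /hits_le.
exact: IHi.
Qed.

Lemma hits_ex dir n k j : hits b dir x n k j ->
  exists2 i, (i <= n)%N &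
    \sum_(l < i) step (b (x, (k + l)%N)) = step dir * j%:Z.
Proof.
elim: n k j => [|n IHn] k [|j] //=; try by exists 0%N => //; rewrite big_ord0 mulr0.
move=> /IHn[i le_in sumE]; exists i.+1 => //; rewrite sum_step_recl sumE.
by case: (b (x, k)) dir {IHn sumE} => -[] /=; rewrite /step; lia.
Qed.

(** Unit steps cannot jump over a level, so ending at or below [- j] forces a visit to exactly [- j]
    on the way. *)
Lemma hits_position_le n k j :
  \sum_(l < n) step (b (x, (k + l)%N)) <= - j%:Z -> hits b false x n k j.
Proof.
elim: n k j => [|n IHn] k [|j] //=; first by rewrite big_ord0; lia.
rewrite sum_step_recl => h; apply: IHn; move: h; rewrite /step.
by case: (b (x, k)) => /= h; lia.
Qed.

End HittingPaths.

(** * From single walks to the sites visited in the frog model *)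

Section FrogDynamics.
Variable b : nat * nat -> bool.

Lemma frog_position_hits_down x n j :
  frog_position b x n <= - j%:Z -> hits b false x n 0 (j + x).
Proof.
move=> h; apply: hits_position_le; rewrite -(lerD2l x%:Z).
by apply: le_trans h _; lia.
Qed.

Lemma hits_frog_position dir x n j : hits b dir x n 0 j ->
  exists2 i, (i <= n)%N &
    frog_position b x i = x%:Z + (if dir then 1 else -1) * j%:Z.
Proof. by move=> /hits_ex[i le_in sumE]; exists i => //; rewrite -sumE. Qed.

Lemma frog_age_add n x a i :
  frog_age b n x = Some a -> frog_age b (i + n) x = Some (i + a)%N.
Proof. by move=> h; elim: i => [//|i IHi]; rewrite addSn /= IHi. Qed.

Lemma frog_age0 n : frog_age b n 0 = Some n.
Proof. by have := @frog_age_add 0 0 0 n erefl; rewrite !addn0. Qed.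

Lemma frog_age_started n x a :
  frog_age b n x = Some a -> exists n', frog_age b n' x = Some 0%N.
Proof.
elim: n a => [|n IHn] a /=; first by case: eqP => // ->; exists 0%N.
case E : (frog_age b n x) => [a'|]; first by move=> _; exact: IHn E.
by case: asboolP => // h _; exists n.+1; rewrite /= E asboolT.
Qed.

(** Go back to the activation time of the frog, then run forward for [a'] steps. *)
Lemma frog_age_all n x a a' :
  frog_age b n x = Some a -> exists n', frog_age b n' x = Some a'.
Proof.
move=> /frog_age_started[n' h]; exists (a' + n')%N.
by rewrite (frog_age_add _ h) addn0.
Qed.

(** The frog at the origin has age [n] at every time [n], so its arrival at [x] wakes the frog there
    unless it is already awake. *)
Lemma frog_awake_of_visit x k : frog_position b 0 k = x%:Z ->
  exists n a, frog_age b n x = Some a.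
Proof.
case: k => [|k] h.
  exists 0%N, 0%N; move: h; rewrite /frog_position big_ord0 /= => h.
  by have -> : x = 0%N by lia.
exists k.+1; rewrite /=; case: (frog_age b k x) => [a|]; first by exists a.+1.
by exists 0%N; rewrite asboolT//; exists 0%N, k; rewrite frog_age0.
Qed.

(** On its way up to [N] the frog of the origin passes through [x] and wakes the frog there, which
    then follows its own path down to [- j]. This serves the lower bound. *)
Lemma hits_visited x N n n' j : hits b true 0 n 0 N -> (x <= N)%N ->
  hits b false x n' 0 (j + x) -> visited_sites b (- j%:Z).
Proof.
move=> up le_xN /hits_frog_position[k _ posk].
have /hits_frog_position[i _ posi] := @hits_leq b 0 true n 0 N x le_xN up.
have [|m [a]] := @frog_awake_of_visit x i; first by rewrite posi; lia.
move=> /frog_age_all -/(_ k)[m' agem']; exists m', x, k; split=> //.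
by rewrite posk; lia.
Qed.

(** This serves the upper bound: activation times are forgotten and only the path of the visiting
    frog is kept. *)
Lemma visited_hits_down (z : int) j : visited_sites b z -> z <= - j%:Z ->
  exists x n, hits b false x n 0 (j + x).
Proof.
move=> [n [x [k [_ ->]]]] h; exists x, k; exact: frog_position_hits_down.
Qed.

Lemma visited0 : visited_sites b 0.
Proof. by exists 0%N, 0%N, 0%N; rewrite /frog_position big_ord0. Qed.

End FrogDynamics.

(** * Finite-horizon hitting probabilities, defined by conditioning on the first step *)

Fixpoint hit_prob (R : pzRingType) (q : R) (n j : nat) : R :=
  if j is j'.+1 then
    if n is n'.+1 then q * hit_prob q n' j' + (1 - q) * hit_prob q n' j.+1
    else 0
  else 1.

Section HitProb.
Variables (R : realType) (q r : R).
Hypotheses (q0 : 0 <= q) (q1 : q <= 1) (r0 : 0 <= r).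
Hypothesis rE : q + (1 - q) * r ^+ 2 = r.

(** By [rE], [r ^+ j] is a stationary solution of the first-step recursion, and it dominates the
    values at [n = 0]. *)
Lemma hit_prob_le n j : hit_prob q n j <= r ^+ j.
Proof.
elim: n j => [|n IHn] [|j] //=; first by rewrite exprn_ge0.
have -> : r ^+ j.+1 = q * r ^+ j + (1 - q) * r ^+ j.+2.
  by rewrite !exprS -{1}rE; ring.
by rewrite lerD// ler_wpM2l// ?subr_ge0.
Qed.

(* [s ^+ j * lam ^+ n] is a supersolution of the recursion for the error. *)
Lemma hit_prob_ge s lam n j : r <= s -> 0 <= lam ->
  q + (1 - q) * s ^+ 2 = lam * s ->
  r ^+ j - lam ^+ n * s ^+ j <= hit_prob q n j.
Proof.
move=> rs lam0 sE; elim: n j => [|n IHn] [|j] /=.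
- by rewrite !expr0 mulr1 subrr.
- by rewrite expr0 mul1r subr_le0 lerXn2r// nnegrE (le_trans r0).
- by rewrite !expr0 mulr1 gerBl exprn_ge0.
have -> : r ^+ j.+1 - lam ^+ n.+1 * s ^+ j.+1 =
    q * (r ^+ j - lam ^+ n * s ^+ j) +
    (1 - q) * (r ^+ j.+2 - lam ^+ n * s ^+ j.+2).
  have -> : r ^+ j.+1 = q * r ^+ j + (1 - q) * r ^+ j.+2.
    by rewrite !exprS -{1}rE; ring.
  have -> : lam ^+ n.+1 * s ^+ j.+1 = lam ^+ n * s ^+ j * (lam * s).
    by rewrite !exprS; ring.
  by rewrite -sE !exprS; ring.
by rewrite lerD// ler_wpM2l// ?subr_ge0.
Qed.

Lemma hit_prob_cvg s lam j : r <= s -> 0 <= lam < 1 ->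
  q + (1 - q) * s ^+ 2 = lam * s ->
  hit_prob q n j @[n --> \oo] --> r ^+ j.
Proof.
move=> rs /andP[lam0 lam1] sE.
apply: (@squeeze_cvgr _ _ _ _ (fun n => r ^+ j - lam ^+ n * s ^+ j)
  (fun=> r ^+ j)).
- by near=> n; rewrite hit_prob_le hit_prob_ge.
- rewrite -[X in _ --> X]subr0; apply: cvgB; first exact: cvg_cst.
  rewrite -[X in _ --> X](mul0r (s ^+ j)); apply: cvgMl.
  by apply: cvg_expr; rewrite ger0_norm.
- exact: cvg_cst.
Unshelve. all: by end_near.
Qed.

End HitProb.

(** * Hitting probabilities of the walk with drift to the right *)

Section DriftedWalk.
Variables (R : realType) (rho : R).
Hypotheses (rho0 : 0 < rho) (rho1 : rho < 1).

Definition step_prob (c : bool) : R :=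
  if c then (1 + rho)^-1 else 1 - (1 + rho)^-1.

(** The probability of ever advancing by one in the direction [dir]: certain with the drift, [rho]
    against it. *)
Definition hit_ratio (dir : bool) : R := if dir then 1 else rho.

Lemma step_prob_negb c : step_prob (~~ c) = 1 - step_prob c.
Proof. by case: c => //=; rewrite subKr. Qed.

Lemma step_prob_ge0 c : 0 <= step_prob c.
Proof.
have h : 0 < 1 + rho by rewrite addr_gt0.
case: c => /=; first by rewrite invr_ge0 ltW.
by rewrite subr_ge0 invf_le1// lerDl ltW.
Qed.

Lemma step_prob_le1 c : step_prob c <= 1.
Proof. by rewrite -subr_ge0 -step_prob_negb step_prob_ge0. Qed.

Lemma hit_ratio_ge0 dir : 0 <= hit_ratio dir.
Proof. by case: dir => //=; exact: ltW. Qed.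

Lemma hit_ratioE dir :
  step_prob dir + (1 - step_prob dir) * hit_ratio dir ^+ 2 = hit_ratio dir.
Proof.
have h : 1 + rho != 0 by rewrite gt_eqF// addr_gt0.
by case: dir => /=; field.
Qed.

Lemma step_hit_prob_le dir n j :
  hit_prob (step_prob dir) n j <= hit_ratio dir ^+ j.
Proof.
exact: hit_prob_le (step_prob_ge0 _) (step_prob_le1 _) (hit_ratio_ge0 _)
  (hit_ratioE _) _ _.
Qed.

(* The supersolution of [hit_prob_ge] with the best rate has base
   [sqrt rho] downwards and [1 / sqrt rho] upwards. *)
Lemma step_hit_prob_cvg dir j :
  hit_prob (step_prob dir) n j @[n --> \oo] --> hit_ratio dir ^+ j.
Proof.
pose s := Num.sqrt rho.
have s0 : 0 < s by rewrite sqrtr_gt0.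
have rhoE : rho = s ^+ 2 by rewrite sqr_sqrtr// ltW.
have s1 : s < 1.
  by rewrite -sqrtr1 ltr_sqrt.
have h : 0 < 1 + s ^+ 2 by rewrite addr_gt0// exprn_gt0.
apply: (hit_prob_cvg (step_prob_ge0 _) (step_prob_le1 _) (hit_ratio_ge0 _)
  (hit_ratioE _) (s := if dir then s^-1 else s) (lam := 2 * s / (1 + s ^+ 2))).
- case: dir => /=; first by rewrite invf_ge1// ltW.
  by rewrite rhoE expr2 ger_pMl// ltW.
(* With [p] the probability of a step [+1], [lam] is [2 sqrt (p (1 - p))], the same for both
   directions. It is below 1 because [(1 - s) ^+ 2 > 0]. *)
- apply/andP; split; first by rewrite divr_ge0 ?(ltW h)// mulr_ge0 ?(ltW s0).
  have s2 : 0 < (1 - s) ^+ 2 by rewrite exprn_gt0// subr_gt0.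
  by rewrite ltr_pdivrMr// mul1r; lra.
case: dir => /=; rewrite rhoE; field; rewrite ?gt_eqF//.
Qed.

End DriftedWalk.

(** * Independence of the walks and probabilities of reaching [- K] *)

Section FrogProbabilities.
Variables (R : realType) (d : measure_display) (T : measurableType d).
Variables (P : probability T R) (rho : R) (xi : nat * nat -> {RV P >-> bool}).
Hypotheses (rho0 : 0 < rho) (rho1 : rho < 1) (hxi : frog_steps rho xi).

Let pr (A : set T) : R := fine (P A).
Let w := step_prob rho.

Let prE A : measurable A -> P A = (pr A)%:E.
Proof. by move=> mA; rewrite fineK// fin_num_measure. Qed.

Let pr_split A B : measurable A -> measurable B ->
  pr A = pr (A `&` B) + pr (A `&` ~` B).
Proof.
move=> mA mB; have mAB : measurable (A `&` B) by exact: measurableI.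
have mAC : measurable (A `&` ~` B).
  by apply: measurableI => //; exact: measurableC.
apply: EFin_inj; rewrite EFinD -!prE// -measureU//.
  by rewrite -setIUr setUCr setIT.
by rewrite setIACA setICr setI0.
Qed.

Let pr_setC A : measurable A -> pr (~` A) = 1 - pr A.
Proof.
move=> mA; have := pr_split measurableT mA; rewrite !setTI.
by rewrite {1}/pr probability_setT /= => ->; rewrite addrC addKr.
Qed.

Let step_event i c := xi i @^-1` [set c].

Let mstep i c : measurable (step_event i c).
Proof. exact: measurable_funPTI. Qed.

Let step_event_negb i c : ~` step_event i c = step_event i (~~ c).
Proof.
apply/seteqP; split=> t; rewrite /step_event /=; first by case: (xi i t) c => -[].
by move=> ->; case: c.
Qed.

Let pr_step i c : pr (step_event i c) = w c.
Proof.
have h : pr (step_event i true) = w true by rewrite /pr (hxi.1 i).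
by case: c => //; rewrite -(step_event_negb i true) pr_setC// h.
Qed.

Let cylinder (s : seq (nat * nat * bool)) : set T :=
  \big[setI/setT]_(ic <- s) step_event ic.1 ic.2.

Let weight (s : seq (nat * nat * bool)) : R := \prod_(ic <- s) w ic.2.

Let mcylinder s : measurable (cylinder s).
Proof. by apply: bigsetI_measurable => i _; exact: mstep. Qed.

Let pr_cylinder s : uniq (unzip1 s) -> pr (cylinder s) = weight s.
Proof.
(* Mutual independence takes one set per index. Since the indices in [s] are distinct, [B i] is the
   singleton of the value prescribed for [i]. *)
move=> us; pose B i := [set c : bool | (i, c) \in s].
have BE ic : ic \in s -> xi ic.1 @^-1` B ic.1 = step_event ic.1 ic.2.
  case: ic => i c ics; rewrite /step_event; congr (_ @^-1` _).
  apply/seteqP; split => c' /=; last by move=> ->.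
  rewrite /B /= => ic's; elim: s us ics ic's {B} => [//|[i' c''] s IHs] /=.
  move=> /andP[i's us]; rewrite !inE.
  have notin e : (i', e) \notin s by apply: contra i's => /(map_f fst).
  case/orP => [/eqP[? ?]|ics] /orP[/eqP[? ?]|ic's]; subst=> //.
  - by move: ic's; rewrite (negbTE (notin _)).
  - by move: ics; rewrite (negbTE (notin _)).
  - exact: IHs.
have mB i : measurable (B i) by [].
have := hxi.2 (unzip1 s) B us mB.
rewrite /unzip1 !big_map (eq_big_seq _ BE) /pr /cylinder => ->.
have -> : (\prod_(i <- s) P (xi i.1 @^-1` B i.1))%E = (weight s)%:E.
  rewrite /weight -prodEFin; apply: eq_big_seq => ic /BE ->.
  by rewrite prE ?pr_step.
by [].
Qed.

Let hit_event dir x n k j := [set t | hits (fun i => xi i t) dir x n k j].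

Let hit_event_step dir x n k j :
  hit_event dir x n.+1 k j.+1 =
  (step_event (x, k) dir `&` hit_event dir x n k.+1 j) `|`
  (step_event (x, k) (~~ dir) `&` hit_event dir x n k.+1 j.+2).
Proof.
apply/seteqP; split=> t; rewrite /hit_event /step_event /=.
  by case: (xi (x, k) t) dir => -[] /=; rewrite ?eqxx; intuition.
by case: (xi (x, k) t) dir => -[] /=; rewrite ?eqxx; intuition.
Qed.

Let hit_event0 dir x n k : hit_event dir x n k 0 = setT.
Proof. by apply/seteqP; split=> t //; rewrite /hit_event; case: n. Qed.

Let mhit dir x n k j : measurable (hit_event dir x n k j).
Proof.
elim: n k j => [|n IHn] k [|j]; rewrite ?hit_event0//.
  rewrite (_ : hit_event _ _ _ _ _ = set0)//.
  by apply/seteqP; split.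
by rewrite hit_event_step; apply: measurableU; apply: measurableI.
Qed.

(** The premise says that [C], of probability [c], is independent of the steps of frog [x] from [k]
    on; the hitting event depends on these steps only. The induction on [n] absorbs step [k] into
    [C], which stays independent of the later steps. *)
Let pr_hit_indep dir x n k j C c : measurable C ->
  (forall s, uniq (unzip1 s) ->
    all (fun ic => (ic.1.1 == x) && (k <= ic.1.2)%N) s ->
    pr (C `&` cylinder s) = c * weight s) ->
  pr (C `&` hit_event dir x n k j) = c * hit_prob (w dir) n j.
Proof.
elim: n k j C c => [|n IHn] k [|j] C c mC CE.
- have := CE [::] isT isT; rewrite /cylinder /weight !big_nil !setIT mulr1.
  by rewrite hit_event0 setIT /= ?mulr1.
- have -> : hit_event dir x 0 k j.+1 = set0 by apply/seteqP; split.
  by rewrite setI0 /pr measure0 /= mulr0.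
- have := CE [::] isT isT; rewrite /cylinder /weight !big_nil !setIT mulr1.
  by rewrite hit_event0 setIT /= ?mulr1.
have CEstep e s : uniq (unzip1 s) ->
    all (fun ic => (ic.1.1 == x) && (k < ic.1.2)%N) s ->
    pr (C `&` step_event (x, k) e `&` cylinder s) = c * w e * weight s.
  move=> us alls; have := CE ((x, k, e) :: s).
  rewrite /cylinder /weight !big_cons /= setIA mulrA; apply.
    rewrite us andbT; apply/mapP => -[[[x' k'] e'] ic /= [_ kE]].
    by have /andP[_] := allP alls _ ic; rewrite /= kE ltnn.
  rewrite eqxx leqnn /=; apply: sub_all alls => ic /andP[-> /=].
  exact: ltnW.
rewrite (pr_split (measurableI _ _ mC (mhit _ _ _ _ _)) (mstep (x, k) dir)).
rewrite step_event_negb hit_event_step.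
set S := step_event (x, k) dir; set S' := step_event (x, k) (~~ dir).
set H1 := hit_event _ _ _ _ _; set H2 := hit_event _ _ _ _ _.
have SS' : S `&` S' = set0 by rewrite /S' -step_event_negb setICr.
have -> : C `&` (S `&` H1 `|` S' `&` H2) `&` S = C `&` S `&` H1.
  rewrite -setIA setIUl; have -> : S' `&` H2 `&` S = set0.
    by rewrite setIAC (setIC S') SS' set0I.
  by rewrite setU0 (setIAC S) setIid setIA.
have -> : C `&` (S `&` H1 `|` S' `&` H2) `&` S' = C `&` S' `&` H2.
  rewrite -setIA setIUl; have -> : S `&` H1 `&` S' = set0.
    by rewrite setIAC SS' set0I.
  by rewrite set0U (setIAC S') setIid setIA.
rewrite (IHn _ _ _ (c * w dir))//; last 2 first.
- by apply: measurableI => //; exact: mstep.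
- exact: CEstep.
rewrite (IHn _ _ _ (c * w (~~ dir)))//; last 2 first.
- by apply: measurableI => //; exact: mstep.
- exact: CEstep.
by rewrite /w step_prob_negb /=; ring.
Qed.

Let pr_hit dir x n j : pr (hit_event dir x n 0 j) = hit_prob (w dir) n j.
Proof.
have := @pr_hit_indep dir x n 0 j setT 1 measurableT.
rewrite setTI mul1r; apply=> s us _.
by rewrite setTI mul1r pr_cylinder.
Qed.

Let no_hit_event K n N : set T :=
  \big[setI/setT]_(x < N) ~` hit_event false x n 0 (K + x).

Let mno_hit K n N : measurable (no_hit_event K n N).
Proof. by apply: bigsetI_measurable => i _; apply: measurableC; exact: mhit. Qed.

(** The cylinder [s] on frogs from [N] on strengthens the induction: it provides the independence
    from the steps of frog [N] that [pr_hit_indep] asks for. *)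
Let pr_no_hit_indep K n N s : uniq (unzip1 s) ->
  all (fun ic => (N <= ic.1.1)%N) s ->
  pr (no_hit_event K n N `&` cylinder s) =
  (\prod_(x < N) (1 - hit_prob (w false) n (K + x))) * weight s.
Proof.
elim: N s => [|N IHN] s us alls.
  by rewrite /no_hit_event !big_ord0 setTI mul1r pr_cylinder.
have alls' : all (fun ic => (N <= ic.1.1)%N) s.
  by apply: sub_all alls => ic /ltnW.
rewrite big_ord_recr /= /no_hit_event big_ord_recr /= -/(no_hit_event K n N).
have mC : measurable (no_hit_event K n N `&` cylinder s) by exact: measurableI.
have := pr_split mC (mhit false N n 0 (K + N)).
rewrite (@pr_hit_indep false N n 0 (K + N) _
  ((\prod_(x < N) (1 - hit_prob (w false) n (K + x))) * weight s))//.
  rewrite IHN// setIAC => /eqP; rewrite addrC -subr_eq => /eqP <-.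
  by ring.
move=> s' us' alls2; rewrite -setIA.
have -> : cylinder s `&` cylinder s' = cylinder (s ++ s').
  by rewrite /cylinder big_cat.
rewrite IHN.
- by rewrite /weight big_cat /= mulrA.
- rewrite /unzip1 map_cat cat_uniq us us' andbT /=.
  apply/hasPn => i /mapP[[[x k] c] /(allP alls2) /= /andP[/eqP -> _] ->].
  apply/mapP => -[[[x' k'] c'] /(allP alls) /=] + [xE _].
  by rewrite -xE ltnn.
- rewrite all_cat alls' /=; apply: sub_all alls2 => ic /andP[/eqP -> _].
  exact: leqnn.
Qed.

Let pr_no_hit K n N : pr (no_hit_event K n N) =
  \prod_(x < N) (1 - hit_prob (w false) n (K + x)).
Proof.
have := @pr_no_hit_indep K n N [::] isT isT.
by rewrite /cylinder /weight !big_nil setIT mulr1.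
Qed.

(* Within [n] steps, some of the first [N] frogs would reach [- K] if awake,
   and the frog at the origin wakes all of them up. *)
Definition reach_event K n N : set T :=
  ~` no_hit_event K n N `&` hit_event true 0 n 0 N.

Lemma measurable_reach_event K n N : measurable (reach_event K n N).
Proof. by apply: measurableI => //; exact: measurableC. Qed.

Lemma reach_event_visited K n N t :
  reach_event K n N t -> visited_sites (fun i => xi i t) (- K%:Z).
Proof.
move=> -[noh up]; apply: contrapT => nv; apply: noh.
rewrite /no_hit_event.
rewrite -(bigcap_mkord _ (fun x => ~` hit_event false x n 0 (K + x))).
move=> x /= xN hitx; apply: nv; exact: hits_visited up (ltnW xN) hitx.
Qed.

(** Both events involve the steps of the frog at the origin, so their probabilities are not
    multiplied; instead [P (A & U) >= P A - P (not U)]. *)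
Lemma prob_reach_event_ge K n N :
  1 - \prod_(x < N) (1 - hit_prob (step_prob rho false) n (K + x)) -
  (1 - hit_prob (step_prob rho true) n N) <= fine (P (reach_event K n N)).
Proof.
rewrite -[X in _ <= X]/(pr _) -/w -pr_no_hit -(pr_hit true 0) -pr_setC//.
have mC : measurable (~` no_hit_event K n N) by exact: measurableC.
rewrite (pr_split mC (mhit true 0 n 0 N)) lerBlDr lerD2l -pr_setC//.
rewrite -lee_fin -!prE; try by [exact: measurableI|exact: measurableC].
  apply: le_measure; rewrite ?inE; last exact: subIsetr.
  - by apply: measurableI => //; exact: measurableC.
  - exact: measurableC.
by apply: measurableI => //; exact: measurableC.
Qed.

(** Whether frog [x] ever wakes up is ignored. This can only enlarge the event, and it makes the
    union bound a sum over single walks. *)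
Definition deep_event K : set T :=
  [set t | exists x n, hits (fun i => xi i t) false x n 0 (K + x)].

(** One parameter bounds both the frogs and the horizon, so that [deep_event] is an increasing
    countable union. *)
Let deep_upto K N : set T :=
  \big[setU/set0]_(x < N) hit_event false x N 0 (K + x).

Let mdeep_upto K N : measurable (deep_upto K N).
Proof. by apply: bigsetU_measurable => i _; exact: mhit. Qed.

Let hits_leS b dir x n k j : hits b dir x n k j -> hits b dir x n.+1 k j.
Proof. by elim: n k j => [|n IHn] k [|j] //= h; exact: IHn. Qed.

Let hits_leqn b dir x n n' k j : (n <= n')%N ->
  hits b dir x n k j -> hits b dir x n' k j.
Proof.
by move=> /subnK <-; elim: (n' - n)%N => [//|i IHi] h; exact/hits_leS/IHi.
Qed.

Let deep_uptoP K N t : deep_upto K N t <->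
  exists2 x, (x < N)%N & hit_event false x N 0 (K + x) t.
Proof.
rewrite /deep_upto -(bigcup_mkord _ (fun x => hit_event false x N 0 (K + x))).
by split=> [[x]|[x]]; exists x.
Qed.

Let deep_eventE K : deep_event K = \bigcup_N deep_upto K N.
Proof.
apply/seteqP; split=> [t [x [n h]]|t [N _ /deep_uptoP[x _ h]]]; last by exists x, N.
exists (maxn x.+1 n) => //; apply/deep_uptoP; exists x; first by rewrite leq_max ltnSn.
by apply: hits_leqn h; exact: leq_maxr.
Qed.

Lemma measurable_deep_event K : measurable (deep_event K).
Proof. by rewrite deep_eventE; apply: bigcup_measurable => N _; exact: mdeep_upto. Qed.

Let prob_deep_upto K N M :
  (P (\big[setU/set0]_(x < M) hit_event false x N 0 (K + x)) <=
   (\sum_(x < M) rho ^+ (K + x))%:E)%E.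
Proof.
elim: M => [|M IHM]; first by rewrite !big_ord0 measure0.
rewrite !big_ord_recr /=.
apply: (le_trans (measureU2 _ _ _)) => //.
  by apply: bigsetU_measurable => i _; exact: mhit.
rewrite EFinD; apply: (leeD IHM).
suff : (P (hit_event false M N 0 (K + M)) <= (rho ^+ (K + M))%:E)%E by [].
by rewrite prE// lee_fin pr_hit (step_hit_prob_le rho0 false).
Qed.

(** The union bound over the frogs gives a geometric series, uniformly in the truncation; continuity
    from below removes the truncation. *)
Lemma prob_deep_event_le K : (P (deep_event K) <= (rho ^+ K / (1 - rho))%:E)%E.
Proof.
have nd : {homo deep_upto K : n m / (n <= m)%N >-> (n <= m)%O}.
  move=> n m nm; apply/subsetPset => t /deep_uptoP[x xn h].
  apply/deep_uptoP; exists x; first exact: leq_trans nm.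
  exact: hits_leqn h.
have := nondecreasing_cvg_mu (mdeep_upto K)
  (bigcup_measurable (fun N _ => mdeep_upto K N)) nd.
rewrite -deep_eventE => /(_ R P) cv; rewrite -(cvg_lim _ cv)//; apply: lime_le.
  by apply/cvg_ex; eexists; exact: cv.
apply: nearW => N /=; apply: le_trans (prob_deep_upto _ _ _) _.
rewrite lee_fin; under eq_bigr do rewrite exprD.
rewrite -mulr_sumr ler_wpM2l ?exprn_ge0 ?(ltW rho0)//.
have r1 : 0 < 1 - rho by rewrite subr_gt0.
rewrite -(ler_pM2l r1) mulfV ?gt_eqF//.
have := subrX1 rho N; have := exprn_ge0 N (ltW rho0).
set s := \sum_(i < N) rho ^+ i => e0 e; lra.
Qed.

End FrogProbabilities.

(* No measurability is needed: the integral of a nonnegative function is a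
   supremum over the simple functions below it. *)
Lemma ge0_le_integral_nomeas (R : realType) (d : measure_display)
    (T : measurableType d) (mu : {measure set T -> \bar R}) (f g : T -> \bar R) :
  (forall x, 0 <= f x)%E -> (forall x, f x <= g x)%E ->
  (\int[mu]_x f x <= \int[mu]_x g x)%E.
Proof.
move=> f0 fg; rewrite !ge0_integralE//; last first.
  by move=> x _; exact: le_trans (fg x).
rewrite !patch_setT; apply: ereal_sup_le => _ [h hf <-]; exists h => // x.
exact: le_trans (fg x).
Qed.

(** * Inequalities for powers, binomial sums and products *)

Lemma lee_expe (R : realDomainType) (x y : \bar R) n :
  (0 <= x -> x <= y -> x ^+ n <= y ^+ n)%E.
Proof.
move=> x0 xy; elim: n => [//|n IHn]; rewrite !expeS lee_pmul// expe_ge0//.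
Qed.

Lemma leq_exp_ffact n m : (n ^ m.+1 <= (n + m) ^_ m.+1)%N.
Proof.
elim: m => [|m IHm]; first by rewrite addn0 ffactn1 expn1.
by rewrite expnS ffactnS addnS leq_mul// -addnS leq_addr.
Qed.

(** The hockey-stick identity sums the binomials to ['C(n + m, m.+1)], and [m.+1] factorial turns
    this into a falling factorial with all factors at least [n]. It writes a power as a sum of
    increments with an explicit generating function. *)
Lemma leq_exp_sum_bin n m :
  (n ^ m.+1 <= m.+1`! * \sum_(l < n) 'C(l + m, m))%N.
Proof.
have -> : (\sum_(l < n) 'C(l + m, m) = 'C(n + m, m.+1))%N.
  elim: n => [|n IHn]; first by rewrite big_ord0 bin_small.
  by rewrite big_ord_recr /= IHn addSn binS.
by rewrite mulnC bin_ffact leq_exp_ffact.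
Qed.

(** Partial sums of the negative binomial series. By Pascal's rule, multiplying the sum for [k.+1]
    by [1 - r] gives at most the sum for [k]. *)
Lemma sum_bin_expr_le (R : realFieldType) (r : R) (k N : nat) :
  0 < r -> r < 1 -> \sum_(l < N) 'C(l + k, k)%:R * r ^+ l <= ((1 - r) ^+ k.+1)^-1.
Proof.
move=> r0 r1; have r1' : 0 < 1 - r by rewrite subr_gt0.
elim: k N => [|k IHk] N.
  under eq_bigr do rewrite bin0 mul1r.
  rewrite expr1 -(ler_pM2l r1') mulfV ?gt_eqF//.
  have := subrX1 r N; have := exprn_ge0 N (ltW r0).
  by set s := \sum_(i < N) r ^+ i => e0 e; lra.
have pascal M : \sum_(l < M.+1) 'C(l + k.+1, k.+1)%:R * r ^+ l =
    \sum_(l < M.+1) 'C(l + k, k)%:R * r ^+ l +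
    r * \sum_(l < M) 'C(l + k.+1, k.+1)%:R * r ^+ l.
  rewrite big_ord_recl [X in _ = X + _]big_ord_recl !add0n !binn mulr_sumr.
  rewrite -addrA -big_split /=; congr (_ + _); apply: eq_bigr => i _.
  by rewrite /bump !add1n addnS binS natrD addSnnS exprS; ring.
rewrite exprSr invfM ler_pdivlMr//; apply: le_trans (IHk N).
case: N => [|N]; first by rewrite !big_ord0 mul0r.
rewrite mulrBr mulr1 lerBlDr [leLHS]pascal lerD2l (mulrC r) ler_wpM2r ?(ltW r0)//.
by rewrite big_ord_recr /= lerDl mulr_ge0// exprn_ge0// ltW.
Qed.

(** Induction through [(1 - a) (1 + S + a) <= 1 + S]. For independent events it bounds the
    probability that none occurs by their expected number. *)
Lemma prod_1_sub_le (R : realFieldType) (a : nat -> R) (N : nat) :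
  (forall i, 0 <= a i <= 1) ->
  \prod_(i < N) (1 - a i) <= (1 + \sum_(i < N) a i)^-1.
Proof.
move=> a01; elim: N => [|N IHN]; first by rewrite !big_ord0 addr0 invr1.
rewrite !big_ord_recr /=; set S := \sum_(i < N) a i in IHN *.
have S0 : 0 <= S by apply: sumr_ge0 => i _; have /andP[] := a01 i.
have /andP[aN0 aN1] := a01 N.
apply: le_trans (_ : (1 + S)^-1 * (1 - a N) <= _).
  by rewrite ler_wpM2r// subr_ge0.
rewrite mulrC ler_pdivrMr ?ltr_wpDr// mulrC ler_pdivlMr; last by lra.
nra.
Qed.

(* Compare [b] with [theta * a]. *)
Lemma expr_add_le (R : realFieldType) (a b theta : R) m :
  0 <= a -> 0 <= b -> 0 < theta ->
  (a + b) ^+ m <= ((1 + theta) * a) ^+ m + ((1 + theta^-1) * b) ^+ m.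
Proof.
move=> a0 b0 t0; have ti0 : 0 < theta^-1 by rewrite invr_gt0.
have [ba|ab] := lerP b (theta * a).
  apply: (@le_trans _ _ (((1 + theta) * a) ^+ m)).
    by rewrite lerXn2r ?nnegrE; nra.
  by rewrite lerDl exprn_ge0//; nra.
have aib : a <= theta^-1 * b by rewrite ler_pdivlMl// ltW.
apply: (@le_trans _ _ (((1 + theta^-1) * b) ^+ m)).
  by rewrite lerXn2r ?nnegrE; nra.
by rewrite lerDr exprn_ge0//; nra.
Qed.

(** * Moment bounds for a fixed [rho] *)

Section FrogMoments.
Variables (R : realType) (d : measure_display) (T : measurableType d).
Variables (P : probability T R) (rho : R) (xi : nat * nat -> {RV P >-> bool}).
Hypotheses (rho0 : 0 < rho) (rho1 : rho < 1) (hxi : frog_steps rho xi).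

Let X t := frog_X R (fun i => xi i t).

Lemma frog_X_ge b (K : nat) : visited_sites b (- K%:Z) -> (K%:R%:E <= frog_X R b)%E.
Proof.
move=> vK; rewrite /frog_X leeNr; apply: ereal_inf_lbound; exists (- K%:Z) => //.
by rewrite mulrNz pmulrn.
Qed.

Lemma frog_X_ge0 b : (0 <= frog_X R b)%E.
Proof. by have := @frog_X_ge b 0; apply; exact: visited0. Qed.

Lemma frog_X_le b (K : nat) :
  (forall z, visited_sites b z -> - K%:Z <= z) -> (frog_X R b <= K%:R%:E)%E.
Proof.
move=> vK; rewrite /frog_X leeNl; apply: le_ereal_inf_tmp => _ [z vz <-].
by rewrite -EFinN lee_fin pmulrn -mulrNz ler_int vK.
Qed.

Lemma deep_event0 t : deep_event xi 0 t.
Proof. by exists 0%N, 0%N. Qed.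

Lemma deep_event_le K K' t : (K' <= K)%N -> deep_event xi K t -> deep_event xi K' t.
Proof.
move=> KK' [x [n h]]; exists x, n; apply: hits_leq h.
by rewrite leq_add2r.
Qed.

Lemma frog_X_le_deep K t : ~ deep_event xi K.+1 t -> (X t <= K%:R%:E)%E.
Proof.
move=> nd; apply: frog_X_le => z vz; rewrite leNgt; apply/negP => zK; apply: nd.
by apply: (visited_hits_down vz); lia.
Qed.

(* The powers of the excess of [X] over [D] are dominated by a sum of
   indicators with binomial weights, whose generating function is explicit. *)
Let weight m l : R := m.+1`!%:R * 'C(l + m, m)%:R.

Let excess (B : R) m D t : \bar R :=
  (\sum_(0 <= l <oo) (B * weight m l)%:E * (\1_(deep_event xi (D + l).+1) t)%:E)%E.

Let term_ge0 (B : R) m D l t : 0 <= B ->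
  (0 <= (B * weight m l)%:E * (\1_(deep_event xi (D + l).+1) t)%:E)%E.
Proof. by move=> B0; rewrite -EFinM lee_fin !mulr_ge0. Qed.

Let X_expr_le (theta : R) m D t : 0 < theta ->
  (X t ^+ m.+1 <= (((1 + theta) * D%:R) ^+ m.+1)%:E +
     excess ((1 + theta^-1) ^+ m.+1) m D t)%E.
Proof.
move=> t0; set B := (1 + theta^-1) ^+ m.+1; set A := ((1 + theta) * D%:R) ^+ m.+1.
have A0 : 0 <= A by rewrite exprn_ge0// mulr_ge0// addr_ge0// ltW.
have B1 : 1 <= B by rewrite exprn_ege1// lerDl invr_ge0 ltW.
have B0 : 0 <= B by apply: le_trans B1.
have w1 l : 1 <= weight m l.
  rewrite /weight -natrM ler1n muln_gt0 fact_gt0 bin_gt0.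
  exact: leq_addl.
(* If every level is reached, [X t] may be [+oo], but so is the series, whose terms are then all at
   least 1. *)
have [dAll|/existsNP[K0 nd]] := pselect (forall K, deep_event xi K t).
  rewrite (_ : excess _ _ _ _ = +oo%E) ?addey ?leey//.
  apply: eq_infty => r; pose N := (Num.trunc `|r|).+1.
  apply: (@le_trans _ _ (N%:R%:E)).
    rewrite lee_fin (le_trans (ler_norm r))// ltW//.
    by have /andP[] := truncn_itv (normr_ge0 r).
  apply: le_trans (nneseries_lim_ge N _); last by move=> *; exact: term_ge0.
  rewrite big_mkord.
  rewrite (_ : N%:R = \sum_(l < N) 1); last by rewrite sumr_const card_ord.
  rewrite -sumEFin; apply: lee_sum => l _; rewrite -EFinM lee_fin.
  by rewrite indicE mem_set// mulr1 mulr_ege1.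
(* [i] is the deepest level reached by any walk; it exists since level 0 always is. *)
have [i dlt nd1] : exists2 i, (forall K, (K <= i)%N -> deep_event xi K t) &
    ~ deep_event xi i.+1 t.
  elim: K0 nd => [|K0 IHK] nd; first by case: nd; exact: deep_event0.
  have [dK|/IHK//] := pselect (deep_event xi K0 t).
  by exists K0 => // K le_K; exact: deep_event_le dK.
apply: (le_trans (lee_expe _ (frog_X_ge0 _) (frog_X_le_deep nd1))).
rewrite -EFin_expe.
(* The subtraction is truncated, so this also covers [i < D], where the excess is 0. *)
have lei : (i <= D + (i - D))%N by rewrite -leq_subLR.
apply: (@le_trans _ _ (A + B * (i - D)%:R ^+ m.+1)%:E).
  rewrite lee_fin /A /B -exprMn; apply: le_trans (expr_add_le _ _ _ t0) => //.
  by rewrite -natrD lerXn2r ?nnegrE// ler_nat.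
rewrite EFinD leeD2l//.
apply: le_trans (nneseries_lim_ge (i - D) _); last by move=> *; exact: term_ge0.
rewrite big_mkord (eq_bigr (fun l : 'I__ => (B * weight m l)%:E)).
  rewrite sumEFin lee_fin -mulr_sumr ler_wpM2l// /weight -mulr_sumr.
  by rewrite -natrX -natr_sum -natrM ler_nat leq_exp_sum_bin.
move=> l _; rewrite indicE mem_set ?mule1//; apply: dlt.
by have := ltn_ord l; lia.
Qed.

(** Integrate [X_expr_le] term by term. The condition on [D] makes the [l]-th indicator have
    probability at most [rho ^+ l], and the negative binomial series sums the weights. *)
Lemma frog_moment_le (theta : R) m D : 0 < theta -> rho ^+ D <= 1 - rho ->
  (frog_moment xi m.+1 <= (((1 + theta) * D%:R) ^+ m.+1 +
    m.+1`!%:R * ((1 + theta^-1) / (1 - rho)) ^+ m.+1)%:E)%E.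
Proof.
move=> t0 Drho; have r1 : 0 < 1 - rho by rewrite subr_gt0.
set A := ((1 + theta) * D%:R) ^+ m.+1; set B := (1 + theta^-1) ^+ m.+1.
have A0 : 0 <= A by rewrite exprn_ge0// mulr_ge0// addr_ge0// ltW.
have B0 : 0 <= B by rewrite exprn_ge0// addr_ge0// invr_ge0 ltW.
have mdeep l := @measurable_deep_event R d T P xi l.
pose term l t : \bar R :=
    ((B * weight m l)%:E * (\1_(deep_event xi (D + l).+1) t)%:E)%E.
have mterm l : measurable_fun [set: T] (term l).
  rewrite /term.
  under eq_fun do rewrite -EFinM; apply/measurable_EFinP.
  by apply: measurable_funM => //; exact: measurable_indic.
apply: (@le_trans _ _ (\int[P]_t (A%:E + excess B m D t))%E).
  apply: ge0_le_integral_nomeas => t; first by rewrite expe_ge0// frog_X_ge0.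
  exact: X_expr_le.
rewrite ge0_integralD//; last 2 first.
- by move=> t _; apply: nneseries_ge0 => *; exact: term_ge0.
- have := @ge0_emeasurable_sum _ _ _ setT _ xpredT (fun l t _ _ => term_ge0 m D l t B0).
  by apply=> l _; exact: mterm.
have -> : (\int[P]_t A%:E = A%:E)%E.
  by rewrite integral_cst// -[RHS]mule1; congr (_ * _)%E; exact: probability_setT.
rewrite EFinD leeD2l//.
rewrite integral_nneseries//; last by move=> l t _; exact: term_ge0.
apply: lime_le.
  apply: is_cvg_nneseries => l _ _; apply: integral_ge0 => t _; exact: term_ge0.
apply: nearW => N; rewrite big_mkord.
apply: (@le_trans _ _ 
    (\sum_(l < N) (B * m.+1`!%:R * ('C(l + m, m)%:R * rho ^+ l))%:E)%E).
  apply: lee_sum => l _.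
  have ind0 t : setT t -> (0 <= (\1_(deep_event xi (D + l).+1) t)%:E :> \bar R)%E.
    by rewrite lee_fin.
  have mind : measurable_fun setT
      (EFin \o \1_(deep_event xi (D + l).+1) : T -> \bar R).
    by apply/measurable_EFinP; exact: measurable_indic.
  rewrite (ge0_integralZl_EFin P measurableT ind0 mind) ?mulr_ge0//.
  rewrite integral_indic// setIT /weight !mulrA EFinM [leRHS]EFinM.
  rewrite lee_wpmul2l ?lee_fin ?mulr_ge0//.
  apply: le_trans (prob_deep_event_le rho0 rho1 hxi _) _.
  rewrite lee_fin ler_pdivrMr// exprS exprD mulrA (mulrC (rho ^+ l)).
  rewrite ler_wpM2r ?exprn_ge0 ?(ltW rho0)//; apply: le_trans Drho.
  by rewrite ler_piMl ?exprn_ge0 ?(ltW rho0)// (ltW rho1).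
rewrite sumEFin lee_fin -mulr_sumr (mulrC B) exprMn -mulrA ler_wpM2l// ler_wpM2l//.
by rewrite exprVn sum_bin_expr_le.
Qed.

(** Markov's inequality on [reach_event], followed by two limits: first the horizon [n], then the
    number [N] of frogs. *)
Lemma frog_moment_ge m K :
  ((K%:R ^+ m.+1 * (1 - (1 + rho ^+ K / (1 - rho))^-1))%:E <= frog_moment xi m.+1)%E.
Proof.
have r1 : 0 < 1 - rho by rewrite subr_gt0.
have mom0 : (0 <= frog_moment xi m.+1)%E.
  by apply: integral_ge0 => t _; rewrite expe_ge0// frog_X_ge0.
have reach n N : ((K%:R ^+ m.+1 * fine (P (reach_event xi K n N)))%:E <=
    frog_moment xi m.+1)%E.
  have mA := @measurable_reach_event R d T P xi K n N.
  have IA : (\int[P]_t (\1_(reach_event xi K n N) t)%:E)%E =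
      P (reach_event xi K n N).
    by rewrite integral_indic// setIT.
  rewrite EFinM fineK ?fin_num_measure// -IA.
  have ind0 t : setT t -> (0 <= (\1_(reach_event xi K n N) t)%:E :> \bar R)%E.
    by rewrite lee_fin.
  have mind : measurable_fun setT
      (EFin \o \1_(reach_event xi K n N) : T -> \bar R).
    by apply/measurable_EFinP; exact: measurable_indic.
  rewrite -(ge0_integralZl_EFin P measurableT ind0 mind) ?exprn_ge0//.
  apply: ge0_le_integral_nomeas => t; first by rewrite -EFinM lee_fin mulr_ge0.
  rewrite indicE; case: (boolP (t \in _)) => [|_]; last first.
    by rewrite mule0 expe_ge0// frog_X_ge0.
  rewrite inE mule1 EFin_expe => /reach_event_visited vK.
  by apply: lee_expe; [rewrite lee_fin|exact: frog_X_ge].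
move: mom0 reach; case: (frog_moment xi m.+1) => [e| _ _|]; [|exact: leey|by []].
rewrite !lee_fin => e0 reach.
(* As [n] grows the frog of the origin reaches [N] with probability tending to 1, so the correction
   term vanishes. *)
have bound N : K%:R ^+ m.+1 * (1 - \prod_(x < N) (1 - rho ^+ (K + x))) <= e.
  apply: (@ler_cvg_to _ (\oo)%classic _ _ (fun n => K%:R ^+ m.+1 *
    (1 - \prod_(x < N) (1 - hit_prob (step_prob rho false) n (K + x)) -
    (1 - hit_prob (step_prob rho true) n N))) (fun=> e)).
  - apply: cvgMr.
    have -> : 1 - \prod_(x < N) (1 - rho ^+ (K + x)) =
        1 - \prod_(x < N) (1 - hit_ratio rho false ^+ (K + x)) -
        (1 - hit_ratio rho true ^+ N).
      by rewrite /= expr1n subrr subr0.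
    apply: cvgB; last first.
      by apply: cvgB; [exact: cvg_cst|exact: (@step_hit_prob_cvg R rho rho0 rho1 true N)].
    apply: cvgB; first exact: cvg_cst.
    apply: cvg_big => [|x _]; first exact: mul_continuous.
    by apply: cvgB; [exact: cvg_cst|
      exact: (@step_hit_prob_cvg R rho rho0 rho1 false (K + x))].
  - exact: cvg_cst.
  apply: nearW => n; rewrite -lee_fin; apply: le_trans (reach n N).
  by rewrite lee_fin ler_wpM2l ?exprn_ge0// (prob_reach_event_ge hxi).
(* The sum of the first [N] hitting probabilities is in closed form, with limit
   [rho ^+ K / (1 - rho)]. *)
apply: (@ler_cvg_to _ (\oo)%classic _ _ (fun N => K%:R ^+ m.+1 *
    (1 - (1 + rho ^+ K * (1 - rho ^+ N) / (1 - rho))^-1)) (fun=> e)).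
- apply: cvgMr; apply: cvgB; first exact: cvg_cst.
  apply: cvgV.
    by rewrite gt_eqF// addr_gt0// divr_gt0// exprn_gt0.
  apply: cvgD; first exact: cvg_cst.
  apply: cvgMl; rewrite -[X in _ --> X]mulr1; apply: cvgMr.
  rewrite -[X in _ --> X]subr0; apply: cvgB; first exact: cvg_cst.
  by apply: cvg_expr; rewrite gtr0_norm.
- exact: cvg_cst.
apply: nearW => N; apply: le_trans (bound N); rewrite ler_wpM2l ?exprn_ge0//.
rewrite lerD2l lerN2.
have -> : rho ^+ K * (1 - rho ^+ N) / (1 - rho) = \sum_(x < N) rho ^+ (K + x).
  under eq_bigr do rewrite exprD.
  rewrite -mulr_sumr -mulrA; congr (_ * _); apply: (canLR (mulfK _)).
    by rewrite gt_eqF.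
  by rewrite -[LHS]opprB subrX1 -mulNr opprB mulrC.
apply: (@prod_1_sub_le _ (fun x => rho ^+ (K + x))) => x.
by rewrite exprn_ge0 ?exprn_ile1// ltW.
Qed.

End FrogMoments.

(** * Explicit bounds on the moments relative to powers of [L] *)

Section Asymptotics.
Variables (R : realType) (d : measure_display) (T : measurableType d).
Variables (P : probability T R) (rho : R) (xi : nat * nat -> {RV P >-> bool}).
Hypotheses (rho_ge : 2^-1 <= rho) (rho1 : rho < 1) (hxi : frog_steps rho xi).
Variable y : R.
Hypotheses (y0 : 0 < y) (y_le : y <= 4^-1) (yE : - ln (1 - rho) = (y ^+ 2)^-1).

Let L := ln (1 - rho) / ln rho.
Let nu := - ln rho.

Let rho0 : 0 < rho. Proof. by apply: lt_le_trans rho_ge; rewrite invr_gt0. Qed.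

Let r1 : 0 < 1 - rho. Proof. by rewrite subr_gt0. Qed.

Let nu0 : 0 < nu.
Proof. by rewrite oppr_gt0 ln_lt0// rho0. Qed.

(** [- ln rho <= 1 / rho - 1], and [1 / rho <= 1 + 2 (1 - rho)] on [[1/2, 1)]. *)
Let nu_le : nu <= 2 * (1 - rho).
Proof.
have := expR_ge1Dx nu; rewrite /nu expRN lnK ?posrE// => h.
have : rho^-1 <= 1 + 2 * (1 - rho).
  rewrite -div1r ler_pdivrMr//.
  have h1 : 0 <= rho - 2^-1 by rewrite subr_ge0.
  by have := mulr_ge0 h1 (ltW r1); lra.
by lra.
Qed.

Let y20 : 0 < y ^+ 2. Proof. exact: exprn_gt0. Qed.

Let nuL : nu * L = (y ^+ 2)^-1.
Proof.
rewrite -yE /nu /L; field.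
by rewrite -oppr_eq0 gt_eqF.
Qed.

Let L0 : 0 < L.
Proof. by rewrite -(pmulr_rgt0 _ nu0) nuL invr_gt0. Qed.

(** By [nu_le], [(1 - rho) L] is at least half of [nu L = 1 / y ^+ 2]. This is what makes the
    moments of the excess negligible. *)
Let rL_inv_le : ((1 - rho) * L)^-1 <= 2 * y ^+ 2.
Proof.
have h : 0 < 2 * y ^+ 2 by rewrite mulr_gt0.
have h' : 0 < (1 - rho) * L by rewrite mulr_gt0.
rewrite -[leRHS]invrK lef_pV2 ?posrE ?invr_gt0//.
by rewrite invfM -nuL mulrA ler_wpM2r ?(ltW L0)// ler_pdivrMl.
Qed.

Let L_inv_le : L^-1 <= 2 * y ^+ 2.
Proof.
have h' : 0 < (1 - rho) * L by rewrite mulr_gt0.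
apply: le_trans rL_inv_le; rewrite lef_pV2 ?posrE//.
by rewrite ler_piMl ?(ltW L0)// gerBl ltW.
Qed.

Let rho_expr K : rho ^+ K = expR (- (nu * K%:R)).
Proof. by rewrite -mulNr /nu opprK expRM_natr lnK ?posrE. Qed.

Let one_sub_rho : 1 - rho = expR (- (nu * L)).
Proof. by rewrite nuL -yE opprK lnK ?posrE. Qed.

Let moment_lo m : 
  ((L ^+ m.+1 * ((1 - y - 2 * y ^+ 2) ^+ m.+1 * (1 - y)))%:E <= frog_moment xi m.+1)%E.
Proof.
pose K := Num.trunc (L * (1 - y)).
have Ly0 : 0 <= L * (1 - y) by rewrite mulr_ge0 ?(ltW L0)//; move: y_le; lra.
have /andP[K_le K_gt] := truncn_itv Ly0.
have q0 : 0 <= 1 - y - 2 * y ^+ 2.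
  have h : y ^+ 2 <= y * 4^-1 by rewrite expr2 ler_wpM2l// ltW.
  by move: y_le h; lra.
apply: le_trans (frog_moment_ge rho0 rho1 hxi m K).
rewrite lee_fin mulrA -exprMn ler_pM//.
- by rewrite exprn_ge0// mulr_ge0// ltW.
- by move: y_le; lra.
- rewrite lerXn2r ?nnegrE//; first by rewrite mulr_ge0// ltW.
  (* Rounding down to [K] loses at most 1, which is at most [2 y ^+ 2 L]. *)
  have : L * L^-1 <= L * (2 * y ^+ 2) by rewrite ler_wpM2l// ltW.
  rewrite mulfV ?gt_eqF// => h; move: K_gt; rewrite -natr1 -/K; nra.
set S := rho ^+ K / (1 - rho).
(* Since [1 - rho] is [rho] to the power [L], [S = exp (nu (L - K)) >= exp (nu L y) = exp (1 /
   y)]. *)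
have S_ge : y^-1 <= S.
  rewrite /S rho_expr one_sub_rho -expRN opprK -expRD.
  apply: (@le_trans _ _ (expR y^-1)).
    by apply: le_trans (expR_ge1Dx _); rewrite lerDr.
  rewrite ler_expR -subr_ge0.
  have -> : - (nu * K%:R) + nu * L - y^-1 = nu * (L * (1 - y) - K%:R).
    have -> : y^-1 = nu * L * y by rewrite nuL; field; rewrite gt_eqF.
    by ring.
  by rewrite mulr_ge0 ?(ltW nu0)// subr_ge0.
rewrite lerD2l lerN2 -[leRHS]invrK lef_pV2 ?posrE ?invr_gt0//.
  by apply: le_trans S_ge _; rewrite lerDr.
by rewrite addr_gt0// (lt_le_trans _ S_ge)// invr_gt0.
Qed.

Let moment_hi m :
  (frog_moment xi m.+1 <= (L ^+ m.+1 * (((1 + y) * (1 + 2 * y ^+ 2)) ^+ m.+1 +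
    m.+1`!%:R * (2 * (y ^+ 2 + y)) ^+ m.+1))%:E)%E.
Proof.
(* Rounding up gives [D >= L], hence [rho ^+ D <= 1 - rho]. *)
pose D := (Num.trunc L).+1.
have /andP[D_le D_gt] := truncn_itv (ltW L0).
have rhoD : rho ^+ D <= 1 - rho.
  rewrite rho_expr one_sub_rho ler_expR lerN2 ler_wpM2l// ltW//.
(* With [theta = y] the factor [1 + y] tends to 1, while [1 + 1 / y] is beaten by the [2 y ^+ 2] of
   [rL_inv_le]. *)
apply: le_trans (frog_moment_le rho0 rho1 hxi m y0 rhoD) _.
have LV : L * L^-1 <= L * (2 * y ^+ 2) by rewrite ler_wpM2l// ltW.
rewrite mulfV ?gt_eqF// in LV.
rewrite lee_fin mulrDr lerD//.
  have a0 : 0 <= (1 + y) * D%:R by rewrite mulr_ge0// addr_ge0// ltW.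
  have b0 : 0 <= L * ((1 + y) * (1 + 2 * y ^+ 2)).
    rewrite mulr_ge0 ?(ltW L0)// mulr_ge0// addr_ge0//; first exact: ltW.
    by rewrite mulr_ge0// ltW.
  rewrite -exprMn lerXn2r ?nnegrE//.
  rewrite mulrCA ler_wpM2l ?addr_ge0 ?(ltW y0)//.
  by rewrite /D -natr1 mulrDr mulr1 lerD.
rewrite mulrCA ler_wpM2l// -exprMn.
have yV0 : 0 < y^-1 by rewrite invr_gt0.
rewrite lerXn2r ?nnegrE//.
- by rewrite divr_ge0 ?(ltW r1)// addr_ge0// ltW.
- by rewrite mulr_ge0 ?(ltW L0)// mulr_ge0// addr_ge0// ltW.
have -> : (1 + y^-1) / (1 - rho) = L * ((1 + y^-1) * ((1 - rho) * L)^-1).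
  by field; rewrite !gt_eqF.
rewrite ler_wpM2l ?(ltW L0)//.
have -> : 2 * (y ^+ 2 + y) = (1 + y^-1) * (2 * y ^+ 2).
  by field; rewrite gt_eqF.
by rewrite ler_wpM2l// addr_ge0// ltW.
Qed.

Lemma frog_moment_ratio_bounds m :
  (((1 - y - 2 * y ^+ 2) ^+ m.+1 * (1 - y))%:E <=
     frog_moment xi m.+1 / ((ln (1 - rho) / ln rho) ^+ m.+1)%:E <=
   (((1 + y) * (1 + 2 * y ^+ 2)) ^+ m.+1 +
      m.+1`!%:R * (2 * (y ^+ 2 + y)) ^+ m.+1)%:E)%E.
Proof.
have := moment_lo m; have := moment_hi m; rewrite -/L.
have Lm0 : 0 < L ^+ m.+1 by rewrite exprn_gt0.
case: (frog_moment xi m.+1) => [e|//|//]; rewrite !lee_fin => hi lo.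
rewrite inver gt_eqF// -EFinM !lee_fin.
by rewrite ler_pdivlMr// ler_pdivrMr// mulrC lo mulrC hi.
Qed.

End Asymptotics.

(** * The limit as [rho] increases to 1 *)

Lemma cvg_inv_sqrt_ln_one_sub (R : realType) :
  (Num.sqrt (- ln (1 - rho)))^-1 @[rho --> (1 : R)^'-] --> (0 : R).
Proof.
apply/cvgrPdist_lt => e e0; near=> rho.
have rho1 : 0 < 1 - rho by rewrite subr_gt0; near: rho; exact: nbhs_left_lt.
have e20 : 0 < (e ^+ 2)^-1 by rewrite invr_gt0 exprn_gt0.
(* Holds as soon as [rho > 1 - exp (- 1 / e ^+ 2)]. *)
have h : (e ^+ 2)^-1 < - ln (1 - rho).
  rewrite ltrNr -ltr_expR lnK ?posrE// ltrBlDr -ltrBlDl.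
  by near: rho; apply: nbhs_left_gt; rewrite gtrBl expR_gt0.
rewrite sub0r normrN ger0_norm ?invr_ge0 ?sqrtr_ge0//.
have l0 : 0 < - ln (1 - rho) by exact: lt_trans h.
rewrite -[ltRHS]invrK ltf_pV2 ?posrE ?invr_gt0 ?sqrtr_gt0//.
have -> : e^-1 = Num.sqrt (e ^+ 2)^-1.
  by rewrite -exprVn sqrtr_sqr gtr0_norm// invr_gt0.
by rewrite ltr_sqrt.
Unshelve. all: by end_near.
Qed.

Theorem corollary4 (R : realType) (d : R -> measure_display)
    (T : forall rho : R, measurableType (d rho))
    (P : forall rho : R, probability (T rho) R)
    (xi : forall rho : R, nat * nat -> {RV (P rho) >-> bool})
    (hxi : forall rho : R, 0 < rho -> rho < 1 -> frog_steps rho (xi rho))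
    (m : nat) (hm : (0 < m)%N) :
  (frog_moment (xi rho) m / ((ln (1 - rho) / ln rho) ^+ m)%:E)%E
    @[rho --> (1 : R)^'-] --> (1 : R)%:E.
Proof.
case: m hm => [//|m] _.
pose y (rho : R) : R := (Num.sqrt (- ln (1 - rho)))^-1.
have y_cvg : y rho @[rho --> (1 : R)^'-] --> (0 : R).
  exact: cvg_inv_sqrt_ln_one_sub.
pose lo (z : R) := (1 - z - 2 * z ^+ 2) ^+ m.+1 * (1 - z).
pose hi (z : R) := ((1 + z) * (1 + 2 * z ^+ 2)) ^+ m.+1 +
  m.+1`!%:R * (2 * (z ^+ 2 + z)) ^+ m.+1.
have cst_cvg (c : R) : (c : R) @[rho --> (1 : R)^'-] --> c by exact: cvg_cst.
have expr_cvg n (f : R -> R) (l : R) : f rho @[rho --> (1 : R)^'-] --> l ->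
    f rho ^+ n @[rho --> (1 : R)^'-] --> l ^+ n.
  move=> fl; exact: (cvg_comp f (fun x => x ^+ n) fl (@exprn_continuous R n l)).
have y2_cvg := expr_cvg 2 _ _ y_cvg.
have lo_cvg : lo (y rho) @[rho --> (1 : R)^'-] --> (1 : R).
  have lo0 : lo 0 = 1 by rewrite /lo expr0n /= mulr0 !subr0 expr1n mulr1.
  rewrite -[X in _ --> X]lo0.
  have q_cvg : 1 - y rho - 2 * y rho ^+ 2 @[rho --> (1 : R)^'-] -->
      (1 - 0 - 2 * 0 ^+ 2 : R).
    by apply: cvgB; [exact: cvgB|exact: cvgM].
  by apply: cvgM; [exact: expr_cvg q_cvg|exact: cvgB].
have hi_cvg : hi (y rho) @[rho --> (1 : R)^'-] --> (1 : R).
  have hi0 : hi 0 = 1.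
    by rewrite /hi !expr0n /= !(mulr0, addr0) mulr1 expr1n expr0n mulr0 addr0.
  rewrite -[X in _ --> X]hi0.
  have q_cvg : (1 + y rho) * (1 + 2 * y rho ^+ 2) @[rho --> (1 : R)^'-] -->
      ((1 + 0) * (1 + 2 * 0 ^+ 2) : R).
    by apply: cvgM; apply: cvgD => //; exact: cvgM.
  have q'_cvg : 2 * (y rho ^+ 2 + y rho) @[rho --> (1 : R)^'-] -->
      (2 * (0 ^+ 2 + 0) : R).
    by apply: cvgM => //; exact: cvgD.
  by apply: cvgD; [exact: expr_cvg q_cvg|apply: cvgM => //; exact: expr_cvg q'_cvg].
apply: (@squeeze_cvge _ _ _ _ (EFin \o lo \o y) _ (EFin \o hi \o y)).
- near=> rho; rewrite /=.
  have rho1 : rho < 1 by near: rho; exact: nbhs_left_lt.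
  have rho2 : 2^-1 <= rho.
    by apply: ltW; near: rho; apply: nbhs_left_gt; rewrite invf_lt1// ltr1n.
  have rho0 : 0 < rho by apply: lt_le_trans rho2; rewrite invr_gt0.
  have l0 : 0 < - ln (1 - rho).
    by rewrite oppr_gt0 ln_lt0// subr_gt0 rho1 gtrBl.
  apply: frog_moment_ratio_bounds => //; first exact: hxi.
  + by rewrite invr_gt0 sqrtr_gt0.
  + near: rho; apply: (cvgr_le _ y_cvg); rewrite invr_gt0//.
  + by rewrite /y exprVn invrK sqr_sqrtr// ltW.
- by apply/fine_cvgP; split; [exact: nearW|exact: lo_cvg].
- by apply/fine_cvgP; split; [exact: nearW|exact: hi_cvg].
Unshelve. all: by end_near.
Qed.
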